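(* For any scaling $(K_n,P_n)_{n\ge 1}$ with $\theta_n=(K_n,P_n)$ such that $\lim_{n\to\infty} n^3\,\tau(\theta_n)=0$, we have $$\lim_{n\to\infty}\mathbb{P}\left[\mathbb{K}(n;\theta_n)\text{ contains at least one triangle}\right]=0 .$$
   Context: Random key graph: for positive integers $K\le P$ write $\theta=(K,P)$, and let $K_1(\theta),\dots,K_n(\theta)$ be i.i.d. random subsets, each uniformly distributed over the $K$-element subsets of a fixed set of $P$ keys. The random key graph $\mathbb{K}(n;\theta)$ has vertex set $\{1,\dots,n\}$, and distinct nodes $i,j$ are adjacent iff $K_i(\theta)\cap K_j(\theta)\neq\emptyset$. Define $\tau(\theta)=\frac{K^3}{P^2}+\left(\frac{K^2}{P}\right)^3$. A scaling is a pair of sequences $K,P$ of positive integers, with values denoted $K_n,P_n$ ($n=1,2,\dots$), such that $K_n\le P_n$ for all $n=2,3,\dots$; one writes $\theta_n=(K_n,P_n)$. *)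

(* Defs.v *)
From HB Require Import structures.
From mathcomp Require Import all_boot all_order all_algebra.
From mathcomp Require Import all_classical all_reals all_analysis.

Set Implicit Arguments.
Unset Strict Implicit.
Unset Printing Implicit Defensive.

Import Order.TTheory GRing.Theory Num.Theory.
Import numFieldNormedType.Exports.

Local Open Scope classical_set_scope.
Local Open Scope ring_scope.

Section FiniteValuedRandomElements.
Context {d : measure_display} {T : measurableType d} {R : realType}.
Variable Pr : probability T R.

(* The finite value type U carries the discrete sigma-algebra, so
   measurability amounts to measurability of the events {X = u}. *)
Definition random_element (U : finType) (X : T -> U) : Prop :=
  forall u : U, measurable (X @^-1` [set u]).

Definition uniform_on (U : finType) (D : {set U}) (X : T -> U) : Prop :=
  forall u : U,
    Pr (X @^-1` [set u]) = (if u \in D then (#|D|%:R)^-1 else 0)%:E.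

Definition mutually_independent (I U : finType) (X : I -> T -> U) : Prop :=
  forall (J : {set I}) (B : I -> {set U}),
    Pr (\bigcap_(i in [set` J]) X i @^-1` [set` B i]) =
    (\prod_(i in J) Pr (X i @^-1` [set` B i]))%E.

End FiniteValuedRandomElements.

Definition key_rings (K P : nat) : {set {set 'I_P}} :=
  [set A : {set 'I_P} | #|A| == K]%SET.

Definition random_key_rings {d : measure_display} {T : measurableType d}
    {R : realType} (Pr : probability T R) (K P n : nat)
    (X : 'I_n -> T -> {set 'I_P}) : Prop :=
  [/\ forall i, random_element (X i),
      mutually_independent Pr X
    & forall i, uniform_on Pr (key_rings K P) (X i)].

Definition key_graph {T : Type} (P n : nat) (X : 'I_n -> T -> {set 'I_P})
    (w : T) : rel 'I_n :=
  fun i j => (i != j) && (X i w :&: X j w != finset.set0)%SET.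

Definition contains_triangle (V : finType) (e : rel V) : bool :=
  [exists i, exists j, exists k,
    [&& uniq [:: i; j; k], e i j, e j k & e i k]].

Definition tau {R : realType} (K P : nat) : R :=
  K%:R ^+ 3 / P%:R ^+ 2 + (K%:R ^+ 2 / P%:R) ^+ 3.

(* Sequences are indexed from 1: their value at 0 is irrelevant. The bound
   K n <= P n is only imposed from n = 2 on. *)
Definition scaling (K P : nat -> nat) : Prop :=
  (forall n, (1 <= n)%N -> (0 < K n)%N /\ (0 < P n)%N) /\
  (forall n, (2 <= n)%N -> (K n <= P n)%N).

(* Main.v *)
(* Let p = K / P. A fixed set S of keys is contained in a given key ring with
   probability at most p ^ |S|. If i, j, k span a triangle, pick keys x, y, z
   shared by (i, j), (j, k), (i, k). Either the three rings have a common key,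
   which has probability at most P p^3 = K^3 / P^2, or x, y, z are pairwise
   distinct, which has probability at most P^3 p^6 = (K^2 / P)^3. The two bounds
   add up to tau, and a union bound over the triples of vertices shows that a
   triangle appears with probability at most n^3 tau. *)
Require Import Defs.
From HB Require Import structures.
From mathcomp Require Import all_boot all_order all_algebra.
From mathcomp Require Import ring.
From mathcomp Require Import all_classical all_reals all_analysis.

Set Implicit Arguments.
Unset Strict Implicit.
Unset Printing Implicit Defensive.

Import Order.TTheory GRing.Theory Num.Theory.
Import numFieldNormedType.Exports.

Local Open Scope classical_set_scope.
Local Open Scope ring_scope.


(** * Counting the subsets that contain a prescribed set *)

(** The ratio of the two binomials is the product of [(K - t) / (P - t)] over [t < s], and each
    factor is at most [K / P] because [K <= P]. Cross-multiplying keeps everything in [nat]. *)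
Lemma bin_sub_le (s K P : nat) :
  (s <= K)%N -> (K <= P)%N ->
  ('C(P - s, K - s) * P ^ s <= 'C(P, K) * K ^ s)%N.
Proof.
move=> + KP; elim: s => [|s IHs] sK; first by rewrite !subn0 !expn0.
have Ps0 : (0 < P - s)%N by rewrite subn_gt0 (leq_trans sK).
(* The factor [P - s] is what the absorption identity [mul_bin_diag] needs to turn the binomial at
   [s + 1] into the one at [s]. *)
rewrite -(leq_pmul2l Ps0) !subnS.
have := mul_bin_diag (P - s) (K - s).-1.
rewrite prednK ?subn_gt0// => diag.
rewrite mulnA diag 2!expnSr.
have step : ((K - s) * P <= (P - s) * K)%N.
  by rewrite !mulnBl [(K * P)%N]mulnC leq_sub2l// leq_mul2l KP orbT.
have -> : ((K - s) * 'C(P - s, K - s) * (P ^ s * P) =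
    ((K - s) * P) * ('C(P - s, K - s) * P ^ s))%N by ring.
have -> : ((P - s) * ('C(P, K) * (K ^ s * K)) =
    ((P - s) * K) * ('C(P, K) * K ^ s))%N by ring.
by rewrite leq_mul// IHs// ltnW.
Qed.

(** Removing [S] is injective on the supersets of [S] and sends those of size [k] to subsets of
    [~: S] of size [k - #|S|]. For [k < #|S|] the truncated difference is 0 and the bound is 1,
    which is too weak to be useful. *)
Lemma card_supsets_le (T : finType) (S : {set T}) (k : nat) :
  (#|[set A : {set T} | (S \subset A) && (#|A| == k)]| <=
   'C(#|T| - #|S|, k - #|S|))%N%SET.
Proof.
have -> : (#|T| - #|S| = #|~: S|)%N%SET by rewrite [in RHS]cardsCs finset.setCK.
rewrite -cards_draws -(@card_in_imset _ _ (fun A => A :\: S)%SET); last first.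
  move=> A B; rewrite !inE => /andP[SA _] /andP[SB _] AB.
  by rewrite -(finset.setID A S) AB -(finset.setID B S) !(finset.setIidPr _)// finset.setDUl
    finset.setDv finset.set0U finset.setDDl finset.setUid.
apply/subset_leq_card/fintype.subsetP => B /imsetP[A]; rewrite !inE => /andP[SA /eqP Ak] ->.
by rewrite finset.setDE subsetIr/= -finset.setDE cardsD (finset.setIidPr SA) Ak.
Qed.

(** * Union bound and measurability for finitely many values *)

Section FiniteUnions.
Context {d : measure_display} {T : measurableType d} {R : realType}.

(** Subadditivity over the indices in [p], whose number is then bounded by the size of the whole
    type: for triples of distinct elements this gives a plain cube. *)
Lemma measure_le_card (mu : {measure set T -> \bar R}) (I : finType) (p : pred I)
    (A : set T) (F : I -> set T) (c : R) :
  0 <= c -> measurable A -> (forall i, p i -> measurable (F i)) ->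
  (A `<=` \bigcup_(i in [set` p]) F i) ->
  (forall i, p i -> (mu (F i) <= c%:E)%E) ->
  (mu A <= (#|I|%:R * c)%:E)%E.
Proof.
move=> c0 mA mF AF Fc; have fp : finite_set [set` p] by exact: finite_finset.
apply: (le_trans (content_sub_fsum mu fp mF mA AF)).
rewrite fsbig_finite//=.
apply: (@le_trans _ _ (\sum_(i <- finmap.enum_fset (fset_set [set` p])) c%:E)%E).
  rewrite big_seq [leRHS]big_seq; apply: lee_sum => i.
  by rewrite in_fset_set// inE; exact: Fc.
rewrite sumEFin lee_fin big_const_seq iter_addr_0 count_predT.
rewrite -[c *+ _]mulr_natl ler_wpM2r// ler_nat.
by rewrite cardE uniq_leq_size// ?finmap.fset_uniq// => i _; rewrite mem_enum.
Qed.

(** Only finitely many value vectors [f] exist, so any event determined by the values is a finite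
    union of finite intersections of the events where [X i] equals [f i]. *)
Lemma measurable_random_elements (I U : finType) (X : I -> T -> U)
    (Q : (I -> U) -> Prop) :
  (forall i, random_element (X i)) -> measurable [set w | Q (X^~ w)].
Proof.
move=> mX.
have -> : [set w | Q (X^~ w)] =
    \bigcup_(f in [set f : {ffun I -> U} | Q f])
      \bigcap_(i in [set: I]) X i @^-1` [set f i].
  apply/seteqP; split=> w /=.
    move=> Qw; exists [ffun i => X i w]; last by move=> i _ /=; rewrite ffunE.
    by rewrite /= (_ : fun_of_fin _ = X^~ w)//; apply/funext => i; rewrite ffunE.
  by move=> [f Qf] fw; rewrite (_ : X^~ w = f)//; apply/funext => i; exact: fw.
apply: fin_bigcup_measurable => [|f _]; first exact: finite_finset.
by apply: fin_bigcap_measurable => [|i _]; [exact: finite_finset | exact: mX].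
Qed.

End FiniteUnions.

(** * Probabilities of containments and of triangles *)

Section KeyRings.
Context {d : measure_display} {T : measurableType d} {R : realType}.
Variable Pr : probability T R.

Lemma uniform_on_preimage (U : finType) (D B : {set U}) (X : T -> U) :
  random_element X -> uniform_on Pr D X ->
  Pr (X @^-1` [set` B]) = (#|B :&: D|%SET%:R / #|D|%:R)%:E.
Proof.
move=> mX uX; have fB : finite_set [set` B] by exact: finite_finset.
have -> : X @^-1` [set` B] = \big[setU/set0]_(u \in [set` B]) X @^-1` [set u].
  rewrite fsbig_setU//; apply/seteqP; split=> w /=; first by move=> ?; exists (X w).
  by move=> [u uB ->].
rewrite measure_fsbig//; last first.
  by apply/trivIsetP => u v _ _ uv; apply/seteqP; split=> // w [/= -> vu];
    rewrite vu eqxx in uv.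
rewrite (eq_fsbigr (fun u => (if u \in D then #|D|%:R^-1 else 0)%:E)); last first.
  by move=> u _; exact: uX.
rewrite fsumEFin//; congr EFin.
transitivity (\sum_(u in B) if u \in D then #|D|%:R^-1 else 0 : R).
  rewrite -big_enum/= [RHS]fsbig_seq ?enum_uniq//; apply: eq_fsbigl.
  by apply/seteqP; split=> u /=; rewrite mem_enum.
rewrite -big_mkcondr/= big_const iter_addr_0 -[_ *+ _]mulr_natl.
by congr (_%:R * _); apply: eq_card => u; rewrite !inE.
Qed.

Variables (K P n : nat) (X : 'I_n -> T -> {set 'I_P}).
Hypotheses (KP : (K <= P)%N) (P0 : (0 < P)%N) (hX : random_key_rings Pr K X).

Lemma supset_key_ring_le (i : 'I_n) (S : {set 'I_P}) :
  (Pr [set w | S \subset X i w] <= ((K%:R / P%:R) ^+ #|S|)%:E)%E.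
Proof.
have [mX _ uX] := hX.
have -> : [set w | S \subset X i w] =
    X i @^-1` [set` [set A : {set 'I_P} | S \subset A]%SET].
  by apply/seteqP; split=> w /=; rewrite inE.
rewrite (uniform_on_preimage _ (mX i) (uX i)) lee_fin.
have cD : #|key_rings K P| = 'C(P, K) by rewrite /key_rings card_draws card_ord.
have D0 : (0 < #|key_rings K P|)%N by rewrite cD bin_gt0.
rewrite expr_div_n ler_pdivrMr ?ltr0n// mulrAC ler_pdivlMr ?exprn_gt0 ?ltr0n//.
rewrite -!natrX -!natrM ler_nat cD [leqRHS]mulnC.
(* If [S] has more than [K] elements, no key ring contains it and the count is 0; otherwise the
   binomial estimate applies. *)
have [SK|KS] := leqP #|S| K; last first.
  rewrite (_ : _ :&: _ = finset.set0)%SET ?cards0//.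
  apply/setP => A; rewrite !inE; apply/negP => /andP[/subset_leq_card SA /eqP AK].
  by rewrite AK leqNgt KS in SA.
apply: leq_trans (bin_sub_le SK KP); rewrite leq_mul2r; apply/orP; right.
have := card_supsets_le S K; rewrite card_ord; apply: leq_trans.
by apply/eq_leq/eq_card => A; rewrite !inE.
Qed.

(** Independence turns the intersection into a product of single-ring bounds, whose exponents add
    up. *)
Lemma supset_key_rings_le (J : {set 'I_n}) (S : 'I_n -> {set 'I_P}) :
  (Pr (\bigcap_(i in [set` J]) [set w | S i \subset X i w]) <=
   ((K%:R / P%:R) ^+ (\sum_(i in J) #|S i|))%:E)%E.
Proof.
have [mX iX _] := hX.
have pre i : [set w | S i \subset X i w] =
    X i @^-1` [set` [set A : {set 'I_P} | S i \subset A]%SET].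
  by apply/seteqP; split=> w /=; rewrite inE.
have mS i : measurable [set w | S i \subset X i w].
  exact: (measurable_random_elements (fun f : 'I_n -> {set 'I_P} => S i \subset f i) mX).
under eq_bigcapr do rewrite pre.
rewrite (iX J (fun i => [set A : {set 'I_P} | S i \subset A]%SET)) expr_sum.
rewrite (eq_bigr (fun i => (fine (Pr [set w | S i \subset X i w]))%:E)); last first.
  by move=> i _; rewrite fineK ?fin_num_measure// pre.
rewrite prodEFin lee_fin; apply: ler_prod => i _.
by rewrite fine_ge0//= -lee_fin fineK ?fin_num_measure// supset_key_ring_le.
Qed.

Lemma supset_three_key_rings_le (i j k : 'I_n) (A B C : {set 'I_P}) :
  uniq [:: i; j; k] ->
  (Pr [set w | [/\ A \subset X i w, B \subset X j w & C \subset X k w]] <=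
   ((K%:R / P%:R) ^+ (#|A| + #|B| + #|C|))%:E)%E.
Proof.
rewrite /= !inE negb_or -andbA andbT => /and3P[ij ik jk].
(* One family gathers the three sets; distinctness of [i], [j], [k] ensures that it takes the values
   [A], [B], [C] there. *)
pose S l := if l == i then A else if l == j then B else C.
have Si : S i = A by rewrite /S eqxx.
have Sj : S j = B by rewrite /S eqxx eq_sym (negbTE ij).
have Sk : S k = C by rewrite /S ![k == _]eq_sym (negbTE ik) (negbTE jk).
have -> : (#|A| + #|B| + #|C| = \sum_(l in [set i; j; k]) #|S l|)%N%SET.
  rewrite finset.setUC big_setU1/=; last by rewrite !inE ![k == _]eq_sym negb_or ik.
  by rewrite big_setU1 ?inE// big_set1 Si Sj Sk addnC.
rewrite (_ : [set w | _] = \bigcap_(l in [set` [set i; j; k]%SET])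
    [set w | S l \subset X l w]); first exact: supset_key_rings_le.
apply/seteqP; split=> w /=.
  move=> [Aw Bw Cw] l /=; rewrite !inE -orbA => /or3P[] /eqP ->.
  - by rewrite Si.
  - by rewrite Sj.
  - by rewrite Sk.
move=> Sw; split; [rewrite -Si|rewrite -Sj|rewrite -Sk]; apply: Sw;
  by rewrite /= !inE eqxx ?orbT.
Qed.

Lemma triangle_at_le (i j k : 'I_n) : uniq [:: i; j; k] ->
  (Pr [set w | [&& key_graph X w i j, key_graph X w j k & key_graph X w i k]] <=
   (tau K P)%:E)%E.
Proof.
move=> uijk; have [mX _ _] := hX.
pose triple (A B C : {set 'I_P}) :=
  [set w | [/\ A \subset X i w, B \subset X j w & C \subset X k w]].
have mtriple A B C : measurable (triple A B C).
  exact: (measurable_random_elements (fun f : 'I_n -> {set 'I_P} =>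
    [/\ A \subset f i, B \subset f j & C \subset f k]) mX).
pose p3 (t : 'I_P * 'I_P * 'I_P) := uniq [:: t.1.1; t.1.2; t.2].
(* [E1]: some key lies in all three rings. [E2]: distinct keys [x], [y], [z] are shared by [(i, j)],
   [(j, k)], [(i, k)], so each ring holds two of them, whence the exponent 6. *)
pose E1 := \bigcup_(x in [set: 'I_P]) triple [set x]%SET [set x]%SET [set x]%SET.
pose E2 := \bigcup_(t in [set` p3])
  triple [set t.1.1; t.2]%SET [set t.1.1; t.1.2]%SET [set t.1.2; t.2]%SET.
have mE1 : measurable E1.
  by apply: fin_bigcup_measurable => //; exact: finite_finset.
have mE2 : measurable E2.
  by apply: fin_bigcup_measurable => //; exact: finite_finset.
have KP0 : 0 <= K%:R / P%:R :> R by rewrite divr_ge0.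
have E1le : (Pr E1 <= (K%:R ^+ 3 / P%:R ^+ 2)%:E)%E.
  have -> : K%:R ^+ 3 / P%:R ^+ 2 = #|'I_P|%:R * (K%:R / P%:R) ^+ 3 :> R.
    by rewrite card_ord; field; rewrite pnatr_eq0 -lt0n.
  apply: (@measure_le_card _ _ _ _ _ xpredT _
    (fun x => triple [set x]%SET [set x]%SET [set x]%SET)) => // [|x _].
    by move=> w [x _ tx]; exists x.
  by have := supset_three_key_rings_le [set x]%SET [set x]%SET [set x]%SET uijk;
    rewrite !cards1.
have E2le : (Pr E2 <= ((K%:R ^+ 2 / P%:R) ^+ 3)%:E)%E.
  have -> : (K%:R ^+ 2 / P%:R) ^+ 3 =
      #|{: 'I_P * 'I_P * 'I_P}|%:R * (K%:R / P%:R) ^+ 6 :> R.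
    by rewrite !card_prod card_ord !natrM; field; rewrite pnatr_eq0 -lt0n.
  apply: (@measure_le_card _ _ _ _ _ p3 _ (fun t =>
    triple [set t.1.1; t.2]%SET [set t.1.1; t.1.2]%SET [set t.1.2; t.2]%SET)) => //.
  move=> [[x y] z]; rewrite /p3/= !inE negb_or -andbA andbT => /and3P[xy xz yz].
  have := supset_three_key_rings_le [set x; z]%SET [set x; y]%SET [set y; z]%SET uijk.
  by rewrite !cards2 xy xz yz.
apply: (@le_trans _ _ (Pr (E1 `|` E2))); last first.
  by rewrite (le_trans (measureU2 _ mE1 mE2))// /tau EFinD leeD.
apply: le_measure; rewrite ?inE.
(* Constant random sets over [unit] express adjacency as a predicate of the value vector [f]
   alone. *)
- exact: (measurable_random_elements (fun f : 'I_n -> {set 'I_P} =>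
    let g := key_graph (fun i (_ : unit) => f i) tt in
    [&& g i j, g j k & g i k]) mX).
- exact: measurableU.
move=> w /=; rewrite /key_graph => /and3P[/andP[_ /finset.set0Pn[x xij]]
  /andP[_ /finset.set0Pn[y yjk]] /andP[_ /finset.set0Pn[z zik]]].
move: xij yjk zik; rewrite !inE => /andP[xi xj] /andP[yj yk] /andP[zi zk].
have sub2 (a b : 'I_P) (D : {set 'I_P}) :
  a \in D -> b \in D -> [set a; b]%SET \subset D.
  by move=> aD bD; rewrite finset.subUset !finset.sub1set aD.
have common (a : 'I_P) : a \in X i w -> a \in X j w -> a \in X k w -> E1 w.
  by move=> ai aj ak; exists a => //; split; rewrite finset.sub1set.
(* Two tests suffice: if [x] is outside ring [k], it differs from [y] and [z], which are in it; if
   [z] is outside ring [j], it differs from [y]. *)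
have [xk|xk] := boolP (x \in X k w); first by left; exact: (common x).
have [zj|zj] := boolP (z \in X j w); first by left; exact: (common z).
right; exists (x, y, z); last by split; exact: sub2.
rewrite /= unfold_in /p3/= !inE negb_or -andbA andbT; apply/and3P; split.
- by apply: contraNneq xk => ->.
- by apply: contraNneq xk => ->.
- by apply: contraNneq zj => <-.
Qed.

Lemma contains_triangle_le :
  (Pr [set w | contains_triangle (key_graph X w)] <= (n%:R ^+ 3 * tau K P)%:E)%E.
Proof.
have [mX _ _] := hX.
pose p3 (t : 'I_n * 'I_n * 'I_n) := uniq [:: t.1.1; t.1.2; t.2].
have -> : n%:R ^+ 3 * tau K P = #|{: 'I_n * 'I_n * 'I_n}|%:R * tau K P :> R.
  by rewrite !card_prod card_ord !natrM; ring.
pose F (f : 'I_n -> {set 'I_P}) := key_graph (fun i (_ : unit) => f i) tt.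
apply: (@measure_le_card _ _ _ _ _ p3 _ (fun t =>
  [set w | [&& key_graph X w t.1.1 t.1.2, key_graph X w t.1.2 t.2
    & key_graph X w t.1.1 t.2]])).
- by rewrite /tau addr_ge0 ?divr_ge0 ?exprn_ge0 ?divr_ge0.
- exact: (measurable_random_elements (fun f => contains_triangle (F f)) mX).
- move=> t _; exact: (measurable_random_elements (fun f =>
    [&& F f t.1.1 t.1.2, F f t.1.2 t.2 & F f t.1.1 t.2]) mX).
- move=> w /= /existsP[i /existsP[j /existsP[k /andP[uijk tri]]]].
  by exists (i, j, k).
- by move=> [[i j] k]; exact: triangle_at_le.
Qed.

End KeyRings.

Theorem theorem3p1 (R : realType) (K P : nat -> nat)
    (d : nat -> measure_display)
    (T : forall n : nat, measurableType (d n))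
    (Pr : forall n : nat, probability (T n) R)
    (X : forall n : nat, 'I_n -> T n -> {set 'I_(P n)})
    (hKP : scaling K P)
    (hX : forall n : nat, (2 <= n)%N -> random_key_rings (Pr n) (K n) (X n))
    (htau : (fun n : nat => n%:R ^+ 3 * tau (K n) (P n) : R) @ \oo --> (0 : R)) :
  (fun n : nat => Pr n [set w : T n | contains_triangle (key_graph (X n) w)])
    @ \oo --> (0%E : \bar R).
Proof.
(* The probability is squeezed between 0 and [n^3 tau], for [n >= 2] only, where the scaling gives
   [K n <= P n] and [hX] gives the law of the rings. *)
apply: (@squeeze_cvge _ _ _ _ (cst 0%E) _
  (fun n => (n%:R ^+ 3 * tau (K n) (P n))%:E)).
- near=> n; have n2 : (2 <= n)%N by near: n; exact: nbhs_infty_ge.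
  rewrite measure_ge0/=; apply: contains_triangle_le (hX _ n2).
  + exact: hKP.2.
  + by have [] := hKP.1 _ (ltnW n2).
- exact: cvg_cst.
- exact: cvg_comp htau _.
Unshelve. all: by end_near. Qed.
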